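(* Let $\mathfrak g$ be a $4$-dimensional unimodular almost-abelian Lie algebra, with codimension-one abelian ideal $\mathfrak n$, equipped with a left-invariant almost-Hermitian structure $(g,J)$ with associated algebraic data $(a,b,v,A)$ such that $A\in\mathfrak{so}(\mathfrak n_1)$ and $A$ commutes with $J$; in particular it satisfies $dJdF=0$. Suppose that $(g,J)$ is a solution to the Bismut--Einstein problem. Then $\mathfrak g$ is isomorphic to one of the following Lie algebras (given by the non-zero brackets of a basis $\{e_1,e_2,e_3,e_4\}$, up to skew-symmetry): (1) $\mathcal A_{3,6}\oplus\mathcal A_1$: $[e_1,e_3]=-e_2$, $[e_2,e_3]=e_1$; the solution is not almost-Kähler; (2) $\mathcal A_{3,1}\oplus\mathcal A_1$: $[e_1,e_2]=e_3$; the solution is almost-Kähler. Both Lie algebras admit compact quotients.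
   Context: A Lie algebra $\mathfrak g$ is almost-abelian if it has a codimension-one abelian ideal $\mathfrak n$. A left-invariant almost-Hermitian structure on $\mathfrak g$ is an inner product $g$ and a $g$-orthogonal $J$ with $J^2=-\mathrm{Id}$, viewed as a left-invariant structure on the simply connected Lie group with Lie algebra $\mathfrak g$. Put $\mathfrak n_1=\mathfrak n\cap J\mathfrak n$. In dimension $4$ choose a $g$-orthonormal basis $\{e_1,\dots,e_4\}$ of $\mathfrak g$ with $\mathfrak n=\mathrm{span}(e_1,e_2,e_3)$, $Je_1=e_4$, $Je_2=e_3$ (so $\mathfrak n_1=\mathrm{span}(e_2,e_3)$). The algebraic data $(a,b,v,A)$, with $a\in\mathbb R$, $b,v\in\mathfrak n_1$, $A\in\mathfrak{gl}(\mathfrak n_1)$, are defined by $[e_4,e_1]=ae_1+v$ and $[e_4,x]=g(b,x)e_1+Ax$ for $x\in\mathfrak n_1$; ''$A$ commutes with $J$'' means that $A$ commutes with $J|_{\mathfrak n_1}$. (The basis $e_1,\dots,e_4$ in the list of Lie algebras is unrelated to this adapted basis.) ''Admits compact quotients'' means that the associated simply connected Lie group admits a lattice (cocompact discrete subgroup). $F(X,Y)=g(JX,Y)$; $(g,J)$ is almost-Kähler if $dF=0$. $JdF=-dF(J\cdot,J\cdot,J\cdot)$. Curvature convention: $R^\nabla_{X,Y}=\nabla_{[X,Y]}-[\nabla_X,\nabla_Y]$. The Chern connection $\nabla$ is the unique connection with $\nabla g=0$, $\nabla J=0$ and torsion $T$ satisfying $T(JX,JY)=-T(X,Y)$. The Bismut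 connection is $\nabla^B=2\nabla^{(0)}-\nabla$, where $\nabla^{(0)}_XY=D^g_XY-\frac12J(D^g_XJ)Y$ and $D^g$ is the Levi-Civita connection (this is Gauduchon's canonical Hermitian connection with parameter $t=-1$). With $\{e_i\}$ an orthonormal frame, $Ric^B(X,Y)=\frac12\sum_{i=1}^4g(R^{\nabla^B}_{X,Y}e_i,Je_i)$. For a $2$-form $\psi$, $\psi^{J,+}(X,Y)=\frac12(\psi(X,Y)+\psi(JX,JY))$. $(g,J)$ solves the Bismut--Einstein problem if $(Ric^B)^{J,+}=\lambda F$ for some $\lambda\in\mathbb R$.
   Formalization: The classification assumes the Lie algebra is not abelian (flat R^4 is a solution isomorphic to neither algebra), and in (1) ''not almost-Kähler'' is asserted only for non-Kähler solutions (A_{3,6}⊕A_1 with b=v=0 and A nonzero is a flat Kähler solution). *)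

(* Defs.v *)
From HB Require Import structures.
From mathcomp Require Import all_boot all_order all_algebra generic_quotient.
From mathcomp Require Import sesquilinear.
From mathcomp Require Import all_classical all_reals all_analysis.
Set Implicit Arguments.
Unset Strict Implicit.
Unset Printing Implicit Defensive.
Import Order.TTheory GRing.Theory Num.Theory.
Import numFieldNormedType.Exports.
Local Open Scope classical_set_scope.
Local Open Scope ring_scope.
Local Open Scope quotient_scope.

Section LieAlgebra.
Context {R : realType} {g : vectType R}.
Implicit Types (lb : g -> g -> g) (n : {vspace g}).

Definition lie_axioms lb : Prop :=
  (forall x, lb x x = 0) /\
  (forall x y z, lb x (lb y z) + lb y (lb z x) + lb z (lb x y) = 0).

Definition endo_trace (f : g -> g) : R :=
  \sum_(i < \dim {:g}) coord (vbasis {:g}) i (f (vbasis {:g})`_i).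

Definition unimodular lb : Prop := forall x, endo_trace (lb x) = 0.

Definition abelian_lie lb : Prop := forall x y, lb x y = 0.

Definition codim1_abelian_ideal lb n : Prop :=
  [/\ (\dim n).+1 = \dim {:g},
      forall x y, y \in n -> lb x y \in n
    & forall x y, x \in n -> y \in n -> lb x y = 0].

End LieAlgebra.

Definition lie_isomorphic (R : realType) (g h : vectType R)
    (lbg : g -> g -> g) (lbh : h -> h -> h) : Prop :=
  exists f : 'Hom(g, h),
    bijective f /\ forall x y, f (lbg x y) = lbh (f x) (f y).

Section AlmostHermitian.
Context {R : realType} {g : vectType R}.
Implicit Types (lb : g -> g -> g) (ip : {dot g for idfun}) (J : 'End(g)).

Definition almost_hermitian ip J : Prop :=
  (forall x, J (J x) = - x) /\ (forall x y, ip (J x) (J y) = ip x y).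

Definition fund_form ip J (x y : g) : R := ip (J x) y.

(* Exterior derivative of left-invariant forms (Chevalley-Eilenberg). *)
Definition ext_d2 lb (w : g -> g -> R) (x y z : g) : R :=
  - w (lb x y) z + w (lb x z) y - w (lb y z) x.

Definition ext_d3 lb (w : g -> g -> g -> R) (x y z t : g) : R :=
  - w (lb x y) z t + w (lb x z) y t - w (lb x t) y z
  - w (lb y z) x t + w (lb y t) x z - w (lb z t) x y.

Definition dF lb ip J : g -> g -> g -> R := ext_d2 lb (fund_form ip J).

Definition JdF lb ip J (x y z : g) : R := - dF lb ip J (J x) (J y) (J z).

Definition almost_kahler lb ip J : Prop := forall x y z, dF lb ip J x y z = 0.

Definition integrable_acs lb J : Prop := forall x y,
  lb (J x) (J y) - J (lb (J x) y) - J (lb x (J y)) - lb x y = 0.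

Definition kahler lb ip J : Prop :=
  almost_kahler lb ip J /\ integrable_acs lb J.

(* Left-invariant connections are bilinear maps [D], with [D x y] the covariant
   derivative of the left-invariant field [y] along [x]; left-invariant
   functions, such as [ip y z], are constant. *)
Definition torsion lb (D : g -> g -> g) (x y : g) : g :=
  D x y - D y x - lb x y.

Definition metric_conn ip (D : g -> g -> g) : Prop :=
  forall x y z, ip (D x y) z + ip y (D x z) = 0.

Definition cov_J (D : g -> g -> g) J (x y : g) : g := D x (J y) - J (D x y).

Definition levi_civita lb ip (D : {bilinear g -> g -> g}) : Prop :=
  metric_conn ip D /\ forall x y, torsion lb D x y = 0.

Definition chern_conn lb ip J (D : {bilinear g -> g -> g}) : Prop :=
  [/\ metric_conn ip D, forall x y, cov_J D J x y = 0
    & forall x y, torsion lb D (J x) (J y) = - torsion lb D x y].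

Definition nabla0 (D : g -> g -> g) J (x y : g) : g :=
  D x y - 2^-1 *: J (cov_J D J x y).

Definition bismut_conn lb ip J (B : g -> g -> g) : Prop :=
  exists D C : {bilinear g -> g -> g},
    [/\ levi_civita lb ip D, chern_conn lb ip J C
      & forall x y, B x y = 2 *: nabla0 D J x y - C x y].

(* Sign: R_{x,y} = nabla_[x,y] - [nabla_x, nabla_y]. *)
Definition curvature lb (B : g -> g -> g) (x y z : g) : g :=
  B (lb x y) z - (B x (B y z) - B y (B x z)).

Definition orthonormal_frame ip (e : 4.-tuple g) : Prop :=
  basis_of {:g} e /\ forall i j : 'I_4, ip e`_i e`_j = (i == j)%:R.

Definition ric_form lb ip J (e : 4.-tuple g) (B : g -> g -> g) (x y : g) : R :=
  2^-1 * \sum_(i < 4) ip (curvature lb B x y e`_i) (J e`_i).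

Definition J_inv_part J (w : g -> g -> R) (x y : g) : R :=
  2^-1 * (w x y + w (J x) (J y)).

(* The Ricci form does not depend on the orthonormal frame [e]. *)
Definition bismut_einstein lb ip J (e : 4.-tuple g) : Prop :=
  exists (B : g -> g -> g) (lambda : R), bismut_conn lb ip J B /\
    forall x y, J_inv_part J (ric_form lb ip J e B) x y
                = lambda * fund_form ip J x y.

End AlmostHermitian.

Section AlgebraicData.
Context {R : realType} {g : vectType R}.
Variables (lb : g -> g -> g) (ip : {dot g for idfun}) (J : 'End(g)).

Definition n_one (n : {vspace g}) : {vspace g} := (n :&: J @: n)%VS.

(* [e`_0, ..., e`_3] are e_1, ..., e_4. *)
Definition adapted_basis (n : {vspace g}) (e : 4.-tuple g) : Prop :=
  [/\ orthonormal_frame ip e, n = <<[:: e`_0; e`_1; e`_2]>>%VS,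
      J e`_0 = e`_3 & J e`_1 = e`_2].

Definition algebraic_data (n : {vspace g}) (e : 4.-tuple g) (a : R)
    (b v : subvs_of (n_one n)) (A : 'End(subvs_of (n_one n))) : Prop :=
  lb e`_3 e`_0 = a *: e`_0 + vsval v /\
  forall x : subvs_of (n_one n),
    lb e`_3 (vsval x) = ip (vsval b) (vsval x) *: e`_0 + vsval (A x).

Definition skew_endo (U : {vspace g}) (A : 'End(subvs_of U)) : Prop :=
  forall x y : subvs_of U, ip (vsval (A x)) (vsval y) = - ip (vsval x) (vsval (A y)).

(* [J] restricted to [U]; meaningful when [U] is [J]-stable. *)
Definition J_restr (U : {vspace g}) (x : subvs_of U) : subvs_of U :=
  vsproj U (J (vsval x)).

Definition commutes_with_J (U : {vspace g}) (A : 'End(subvs_of U)) : Prop :=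
  forall x : subvs_of U, A (J_restr x) = J_restr (A x).

End AlgebraicData.

Section Models.
Context {R : realType}.

(* Bracket on R^4 with [e_i, e_j] = c i j - c j i; a table [c] lists each
   nonzero bracket once, with indices shifted down by one. *)
Definition table_bracket (c : nat -> nat -> 'rV[R]_4) (x y : 'rV[R]_4) :
    'rV[R]_4 :=
  \sum_(i < 4) \sum_(j < 4) (x 0 i * y 0 j) *: (c i j - c j i).

Definition std (k : nat) : 'rV[R]_4 := delta_mx 0 (inord k).

Definition A36_A1 : 'rV[R]_4 -> 'rV[R]_4 -> 'rV[R]_4 :=
  table_bracket (fun i j => match i, j with
    | 0%N, 2%N => - std 1
    | 1%N, 2%N => std 0
    | _, _ => 0
    end).

Definition A31_A1 : 'rV[R]_4 -> 'rV[R]_4 -> 'rV[R]_4 :=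
  table_bracket (fun i j => match i, j with
    | 0%N, 1%N => std 2
    | _, _ => 0
    end).

End Models.

Section LieGroups.
Context {R : realType}.

Fixpoint Ck (V W : normedModType R) (k : nat) (f : V -> W) : Prop :=
  if k is k'.+1 then
    forall v, (forall x, derivable f x v) /\ Ck k' (fun x => 'D_v f x)
  else continuous f.

Definition smooth (V W : normedModType R) (f : V -> W) : Prop :=
  forall k, Ck k f.

(* Lie groups with underlying manifold R^(n+1). They are simply connected, and
   every simply connected solvable Lie group of positive dimension is
   diffeomorphic to some R^(n+1). *)
Record lieGroup (n : nat) := LieGroup {
  lg_mul : 'rV[R]_n.+1 -> 'rV[R]_n.+1 -> 'rV[R]_n.+1;
  lg_one : 'rV[R]_n.+1;
  lg_inv : 'rV[R]_n.+1 -> 'rV[R]_n.+1;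
  lg_mulA : associative lg_mul;
  lg_mul1 : left_id lg_one lg_mul;
  lg_mulV : left_inverse lg_one lg_inv lg_mul;
  lg_smooth_mul :
    smooth (fun p : 'rV[R]_n.+1 * 'rV[R]_n.+1 => lg_mul p.1 p.2);
  lg_smooth_inv : smooth lg_inv }.

Section Theory.
Variables (n : nat) (G : lieGroup n).
Notation V := 'rV[R]_n.+1.

(* The left-invariant vector field on [G] with value [u] at the identity. *)
Definition left_inv_field (u p : V) : V := 'D_u (lg_mul G p) (lg_one G).

(* Value at the identity of the commutator of two left-invariant fields. *)
Definition lg_bracket (u v : V) : V :=
  'D_u (left_inv_field v) (lg_one G) - 'D_v (left_inv_field u) (lg_one G).

Record subgroup := Subgroup {
  sg_set :> set V;
  sg_one : sg_set (lg_one G);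
  sg_mul : forall x y, sg_set x -> sg_set y -> sg_set (lg_mul G x y);
  sg_inv : forall x, sg_set x -> sg_set (lg_inv G x) }.

Definition discrete_subgroup (L : subgroup) : Prop :=
  forall x, sg_set L x -> isolated L x.

Lemma lg_mulrV x : lg_mul G x (lg_inv G x) = lg_one G.
Proof.
rewrite -[LHS](lg_mul1 G) -[in LHS](lg_mulV G (lg_inv G x)).
by rewrite -(lg_mulA G) (lg_mulA G (lg_inv G x)) (lg_mulV G) (lg_mul1 G)
  (lg_mulV G).
Qed.

Lemma lg_mulr1 x : lg_mul G x (lg_one G) = x.
Proof. by rewrite -(lg_mulV G x) (lg_mulA G) lg_mulrV (lg_mul1 G). Qed.

Lemma lg_mulK x y : lg_mul G x (lg_mul G (lg_inv G x) y) = y.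
Proof. by rewrite (lg_mulA G) lg_mulrV (lg_mul1 G). Qed.

Lemma lg_mulKl x y : lg_mul G (lg_inv G x) (lg_mul G x y) = y.
Proof. by rewrite (lg_mulA G) (lg_mulV G) (lg_mul1 G). Qed.

Lemma lg_invK x : lg_inv G (lg_inv G x) = x.
Proof.
by rewrite -[LHS]lg_mulr1 -[in LHS](lg_mulV G x) lg_mulKl.
Qed.

Definition coset_rel (L : subgroup) (x y : V) : bool :=
  `[< sg_set L (lg_mul G (lg_inv G x) y) >].

Lemma coset_rel_equiv L : equiv_class_of (coset_rel L).
Proof.
have sym x y : coset_rel L x y -> coset_rel L y x.
  move=> /asboolP /sg_inv h; apply/asboolP; move: h.
  suff -> : lg_inv G (lg_mul G (lg_inv G x) y) = lg_mul G (lg_inv G y) x by [].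
  set z := lg_mul G (lg_inv G x) y; set w := lg_mul G (lg_inv G y) x.
  have zw : lg_mul G z w = lg_one G.
    by rewrite /z /w -(lg_mulA G) lg_mulK (lg_mulV G).
  by rewrite -[LHS]lg_mulr1 -zw lg_mulKl.
split.
- by move=> x; apply/asboolP; rewrite (lg_mulV G); exact: sg_one.
- by move=> x y; apply/idP/idP; exact: sym.
- move=> y x z /asboolP xy /asboolP yz; apply/asboolP.
  by have := sg_mul xy yz; rewrite -(lg_mulA G) lg_mulK.
Qed.

Definition coset_equiv (L : subgroup) : equiv_rel V :=
  EquivRelPack (coset_rel_equiv L).

Definition coset_space (L : subgroup) : topologicalType :=
  quotient_topology {eq_quot coset_equiv L}.

Definition lattice (L : subgroup) : Prop :=
  discrete_subgroup L /\ compact [set: coset_space L].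

End Theory.
End LieGroups.

Definition admits_compact_quotients (R : realType) (g : vectType R)
    (lb : g -> g -> g) : Prop :=
  exists (n : nat) (G : @lieGroup R n),
    lie_isomorphic lb (lg_bracket G) /\ exists L : subgroup G, lattice L.

(* Main.v *)
Require Import Defs.
From HB Require Import structures.
From mathcomp Require Import all_boot all_order all_algebra.
From mathcomp Require Import sesquilinear.
From mathcomp Require Import ring lra zify.
From mathcomp Require Import all_classical all_reals all_analysis.

(** In the adapted frame, write [M] for the restriction of [ad e_4] to the
    abelian ideal; it is given by [v], [b] and the rotation rate [al] of [A], and
    unimodularity forces [a = 0]. Then [dF] only involves [v].
    A Hermitian connection has values in [u(2)], whose commutators are
    trace-free over [C], so [Ric^B(x, y) = theta [x, y]] for the linear form
    [theta z = g(B_z e_1, e_4) + g(B_z e_2, e_3)]. Koszul's formula and the trace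
    of the torsion identity of the Chern connection give
    [theta e_1 = 0] and [theta = g(v + b/2, .)] on [n_1]. Evaluating the
    Bismut-Einstein equation on [(e_2, e_3)] gives [lambda = 0], hence [theta]
    kills the derived algebra: [g(v, v + b/2) = 0] and [al (v + b/2) = 0].
    Either [al = 0] and [v = 0], and the algebra is Heisenberg plus a line, or
    [M] has eigenvalues [0] and [+- i w] with [w > 0] and is diagonalizable, so
    that the algebra is that of plane motions plus a line.
    On the group side, the integer points form a lattice of the Heisenberg group
    times [R]; in the universal cover of the plane motions times [R], a lattice is
    generated by the integer translations and the rotations by [2 pi Z], which
    are trivial on the plane. *)

Set Implicit Arguments.
Unset Strict Implicit.
Unset Printing Implicit Defensive.
Import Order.TTheory GRing.Theory Num.Theory.
Import numFieldNormedType.Exports.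
Local Open Scope classical_set_scope.
Local Open Scope ring_scope.

(** * Smooth maps *)

Section Smoothness.
Context {R : realType} {V : normedModType R}.

(** A class containing the coordinates of both group laws and stable under directional derivatives,
    so that smoothness follows by induction. In the affine case one differential [df] serves at
    every point. *)
Inductive trig_poly : (V -> R) -> Prop :=
| trig_poly_affine f df : (forall x, is_diff x f df) -> trig_poly f
| trig_poly_add f g : trig_poly f -> trig_poly g -> trig_poly (f + g)
| trig_poly_mul f g : trig_poly f -> trig_poly g -> trig_poly (f * g)
| trig_poly_cos f : trig_poly f -> trig_poly (cos \o f)
| trig_poly_sin f : trig_poly f -> trig_poly (sin \o f).

Lemma trig_poly_cst c : trig_poly (cst c).
Proof. by apply: (@trig_poly_affine _ 0) => x; exact: is_diff_cst. Qed.

Lemma trig_poly_opp f : trig_poly f -> trig_poly (- f).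
Proof.
move=> tf; rewrite (_ : - f = cst (-1) * f).
  exact: trig_poly_mul (trig_poly_cst _) tf.
by apply/funext => x; rewrite fctE /= mulN1r.
Qed.

Lemma is_diff_sin (x : R) : is_diff x sin ( *:%R^~ (cos x)).
Proof.
have d : differentiable (@sin R) x by exact/derivable1_diffP/derivable_sin.
apply: DiffDef => //; apply/funext => h.
rewrite -[h in LHS]mulr1 -[h * 1]/(h *: 1) linearZ /= -deriveE //.
by rewrite derive_val.
Qed.

Lemma is_diff_cos (x : R) : is_diff x cos ( *:%R^~ (- sin x)).
Proof.
have d : differentiable (@cos R) x by exact/derivable1_diffP/derivable_cos.
apply: DiffDef => //; apply/funext => h.
rewrite -[h in LHS]mulr1 -[h * 1]/(h *: 1) linearZ /= -deriveE //.
by rewrite derive_val.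
Qed.

(** The sum, product and chain rules build the differential along the structure of [f]. Its value on
    a fixed vector stays in the class, which is what iterated differentiation needs. *)
Lemma trig_poly_diff f : trig_poly f ->
  exists df : V -> V -> R,
    (forall x, is_diff x f (df x)) /\ forall v, trig_poly (df^~ v).
Proof.
elim=> {f}.
- move=> f df dfE; exists (fun=> df); split=> // v; exact: trig_poly_cst.
- move=> f g _ [df [dfE dft]] _ [dg [dgE dgt]].
  exists (fun x => df x + dg x); split=> [x|v]; first exact: is_diffD.
  exact: trig_poly_add.
- move=> f g tf [df [dfE dft]] tg [dg [dgE dgt]].
  exists (fun x => f x *: dg x + g x *: df x); split=> [x|v].
    exact: is_diffM.
  by apply: trig_poly_add; apply: trig_poly_mul.
- move=> f tf [df [dfE dft]].
  exists (fun x => ( *:%R^~ (- sin (f x))) \o df x); split=> [x|v].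
    exact: is_diff_comp (is_diff_cos _).
  apply: (@trig_poly_mul (df^~ v)) => //.
  exact/trig_poly_opp/trig_poly_sin.
- move=> f tf [df [dfE dft]].
  exists (fun x => ( *:%R^~ (cos (f x))) \o df x); split=> [x|v].
    exact: is_diff_comp (is_diff_sin _).
  apply: (@trig_poly_mul (df^~ v)) => //; exact: trig_poly_cos.
Qed.

Lemma trig_poly_differentiable f x : trig_poly f -> differentiable f x.
Proof. by move=> /trig_poly_diff[df [/(_ x)]]. Qed.

Lemma trig_poly_derive f v : trig_poly f -> trig_poly ('D_v f).
Proof.
move=> tf; have [df [dfE dft]] := trig_poly_diff tf.
rewrite (_ : 'D_v f = df^~ v) //; apply/funext => x.
by rewrite deriveE ?diff_val //; exact: trig_poly_differentiable.
Qed.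

Lemma trig_poly_smooth n (M : V -> 'rV[R]_n.+1) :
  (forall j, trig_poly (fun x => M x 0 j)) -> smooth M.
Proof.
move=> tM k; elim: k M tM => [|k IHk] M tM /=.
  move=> x; apply: differentiable_continuous.
  (* Differentiability passes from the scalar coordinates to the vector-valued map through its
     expansion in the standard basis. *)
  rewrite (_ : M = \sum_j fun x => M x 0 j *: delta_mx 0 j).
    apply: differentiable_sum => j; apply: differentiableZl.
    exact: trig_poly_differentiable.
  by apply/funext => y; rewrite fct_sumE [LHS]row_sum_delta.
move=> v.
have dM x : derivable M x v.
  apply/derivable_mxP => i j; rewrite (ord1 i).
  exact/diff_derivable/trig_poly_differentiable.
split=> //; apply: IHk => j.
rewrite (_ : (fun x => _) = 'D_v (fun x => M x 0 j)).
  exact: trig_poly_derive.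
by apply/funext => x; rewrite derive_mx // mxE.
Qed.

End Smoothness.

(** * Coordinates and derivatives on four-dimensional row vectors *)

Lemma ord4_ind (P : 'I_4 -> Prop) :
  P (inord 0) -> P (inord 1) -> P (inord 2) -> P (inord 3) -> forall i, P i.
Proof.
move=> p0 p1 p2 p3 i; rewrite -(inord_val i).
by case: i => -[|[|[|[|]]]].
Qed.

Lemma sum_ord4 (V : nmodType) (F : 'I_4 -> V) :
  \sum_(i < 4) F i = F (inord 0) + F (inord 1) + F (inord 2) + F (inord 3).
Proof.
rewrite !big_ord_recr big_ord0 /= add0r.
by congr (_ + _ + _ + _); congr F; apply/val_inj; rewrite /= inordK.
Qed.

Section Row4.
Context {R : realType}.
Implicit Types x y : 'rV[R]_4.

Definition row4 (c0 c1 c2 c3 : R) : 'rV[R]_4 := \row_i [:: c0; c1; c2; c3]`_i.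

Lemma row4E c0 c1 c2 c3 :
  ((row4 c0 c1 c2 c3 0 (inord 0) = c0) * (row4 c0 c1 c2 c3 0 (inord 1) = c1) *
  (row4 c0 c1 c2 c3 0 (inord 2) = c2) * (row4 c0 c1 c2 c3 0 (inord 3) = c3))%type.
Proof. by rewrite !mxE !inordK. Qed.

Lemma row4P x y :
  x 0 (inord 0) = y 0 (inord 0) -> x 0 (inord 1) = y 0 (inord 1) ->
  x 0 (inord 2) = y 0 (inord 2) -> x 0 (inord 3) = y 0 (inord 3) -> x = y.
Proof. by move=> *; apply/rowP; apply: ord4_ind. Qed.

Lemma stdE (k : nat) (i : 'I_4) : (std k : 'rV[R]_4) 0 i = (i == inord k)%:R.
Proof. by rewrite mxE eqxx. Qed.

Lemma inord4_eq k l : (k < 4)%N -> (l < 4)%N ->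
  ((inord k : 'I_4) == inord l) = (k == l).
Proof. by move=> k4 l4; rewrite -val_eqE /= !inordK. Qed.

Lemma A31_A1E x y :
  A31_A1 x y =
  row4 0 0 (x 0 (inord 0) * y 0 (inord 1) - x 0 (inord 1) * y 0 (inord 0)) 0.
Proof.
rewrite /A31_A1 /table_bracket !sum_ord4 !inordK //.
by apply: row4P; rewrite row4E !(mxE, stdE) ?inord4_eq //=; ring.
Qed.

Lemma A36_A1E x y :
  A36_A1 x y = row4 (x 0 (inord 1) * y 0 (inord 2) - x 0 (inord 2) * y 0 (inord 1))
    (x 0 (inord 2) * y 0 (inord 0) - x 0 (inord 0) * y 0 (inord 2)) 0 0.
Proof.
rewrite /A36_A1 /table_bracket !sum_ord4 !inordK //.
by apply: row4P; rewrite row4E !(mxE, stdE) ?inord4_eq //=; ring.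
Qed.

Lemma derive_row4 (V : normedModType R) (f0 f1 f2 f3 : V -> R) (t w : V)
    (d0 d1 d2 d3 : R) :
  is_derive t w f0 d0 -> is_derive t w f1 d1 -> is_derive t w f2 d2 ->
  is_derive t w f3 d3 ->
  'D_w (fun z => row4 (f0 z) (f1 z) (f2 z) (f3 z)) t = row4 d0 d1 d2 d3.
Proof.
move=> h0 h1 h2 h3; pose f := [:: f0; f1; f2; f3]; pose d := [:: d0; d1; d2; d3].
have fE j : (fun z => row4 (f0 z) (f1 z) (f2 z) (f3 z) 0 j) = nth f0 f j.
  by apply/funext => z; rewrite !mxE; move: j; apply: ord4_ind; rewrite inordK.
have fd (j : 'I_4) : is_derive t w (nth f0 f j) d`_j.
  by move: j; apply: ord4_ind; rewrite inordK.
rewrite derive_mx.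
  apply/rowP => j; rewrite !mxE.
  by rewrite (_ : (fun _ => _) = nth f0 f j) ?(@derive_val _ _ _ _ _ _ _ (fd j)) //
    -fE; apply/funext => z; rewrite mxE.
apply/derivable_mxP => i j; rewrite (ord1 i) fE.
by have [] := fd j.
Qed.

Lemma is_diff_linear (V : normedModType R) (f : V -> R) z :
  linear (f : V -> R^o) -> continuous f -> is_diff z f f.
Proof.
move=> lin cf.
pose aM := GRing.isLinear.Build _ _ _ _ _ lin.
pose aL : {linear V -> R^o} := HB.pack (f : V -> R^o) aM.
apply: DiffDef; first exact: (@linear_differentiable _ _ _ aL).
by rewrite (@diff_lin _ _ _ aL).
Qed.

Lemma trig_poly_linear (V : normedModType R) (f : V -> R) :
  linear (f : V -> R^o) -> continuous f -> trig_poly f.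
Proof.
by move=> lin cf; apply: trig_poly_affine => z; exact: is_diff_linear.
Qed.

Lemma is_diff_coord j x :
  is_diff x (fun y : 'rV[R]_4 => y 0 j) (fun y : 'rV[R]_4 => y 0 j).
Proof.
apply: is_diff_linear; last exact: coord_continuous.
by move=> c u v; rewrite !mxE.
Qed.

Lemma trig_poly_coord j : trig_poly (fun x : 'rV[R]_4 => x 0 j).
Proof. by apply: trig_poly_affine => x; exact: is_diff_coord. Qed.

Lemma trig_poly_fst j : trig_poly (fun p : 'rV[R]_4 * 'rV[R]_4 => p.1 0 j).
Proof.
apply: trig_poly_linear; first by move=> c u v; rewrite !mxE.
move=> p; apply: (@continuous_comp _ _ _ fst (fun x : 'rV[R]_4 => x 0 j)).
  exact: cvg_fst.
exact: coord_continuous.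
Qed.

Lemma trig_poly_snd j : trig_poly (fun p : 'rV[R]_4 * 'rV[R]_4 => p.2 0 j).
Proof.
apply: trig_poly_linear; first by move=> c u v; rewrite !mxE.
move=> p; apply: (@continuous_comp _ _ _ snd (fun x : 'rV[R]_4 => x 0 j)).
  exact: cvg_snd.
exact: coord_continuous.
Qed.

Lemma smooth_row4 (V : normedModType R) (f0 f1 f2 f3 : V -> R) :
  trig_poly f0 -> trig_poly f1 -> trig_poly f2 -> trig_poly f3 ->
  smooth (fun z => row4 (f0 z) (f1 z) (f2 z) (f3 z)).
Proof.
move=> t0 t1 t2 t3; apply: trig_poly_smooth; apply: ord4_ind.
- by rewrite (_ : (fun _ => _) = f0) //; apply/funext => z; rewrite row4E.
- by rewrite (_ : (fun _ => _) = f1) //; apply/funext => z; rewrite row4E.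
- by rewrite (_ : (fun _ => _) = f2) //; apply/funext => z; rewrite row4E.
- by rewrite (_ : (fun _ => _) = f3) //; apply/funext => z; rewrite row4E.
Qed.

(** Along the line through [t] in the direction [w] the difference quotient is constant, so no
    regularity of [f] elsewhere is involved. *)
Lemma is_derive_affine (V : normedModType R) (f : V -> R) (t w : V) (d : R) :
  (forall h, f (h *: w + t) = f t + h * d) -> is_derive t w f d.
Proof.
move=> fE; have fd : h^-1 *: (f (h *: w + t) - f t) @[h --> 0^'] --> d.
  apply: cvg_trans (@cvg_cst _ d _ 0^' _); apply: near_eq_cvg.
  near=> h; have h0 : h != 0 by near: h; exact: nbhs_dnbhs_neq.
  by rewrite fE addrC addKr [_ *: _]mulKf.
by apply: DeriveDef; [apply/cvg_ex; exists d | exact: cvg_lim].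
Unshelve. all: by end_near. Qed.

End Row4.

(** * Lattices *)

Section Lattices.
Context {R : realType} {n : nat} (G : @lieGroup R n).

(** A compact set meeting every left coset projects continuously onto the quotient. *)
Lemma compact_coset_space (L : subgroup G) (K : set 'rV[R]_n.+1) :
  compact K -> (forall x, exists2 l, sg_set L l & K (lg_mul G x l)) ->
  compact [set: coset_space L].
Proof.
move=> cK KL.
have -> : [set: coset_space L] = (\pi_(coset_space L))%qT @` K.
  apply/seteqP; split=> // q _; rewrite -[q]reprK.
  have [l Ll Kl] := KL (repr q); exists (lg_mul G (repr q) l) => //.
  apply/esym/(@eqmodP _ (coset_equiv L)).
  by apply/asboolP; rewrite lg_mulKl.
apply: continuous_compact cK.
by apply/continuous_subspaceT; exact: pi_continuous.
Qed.

(** Balls are those of the sup norm, so the unit ball around a point of [L] contains no other point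
    of [L]. *)
Lemma separated_discrete (L : subgroup G) :
  (forall x y, sg_set L x -> sg_set L y ->
     (forall i, `|x 0 i - y 0 i| < 1) -> x = y) ->
  discrete_subgroup L.
Proof.
move=> sepL x Lx; split; first exact/mem_set.
exists (ball x 1); first exact: nbhsx_ballx.
apply/seteqP; split=> [y [[_ xy] Ly]|y ->] /=; last by split=> //; exact: ballxx.
by apply/esym/sepL => // i; exact: xy.
Qed.

End Lattices.

Lemma box_compact (R : realType) (lo hi : R) :
  compact [set x : 'rV[R]_4 | forall j, lo <= x 0 j <= hi].
Proof.
have -> : [set x : 'rV[R]_4 | forall j, lo <= x 0 j <= hi] =
    [set x | forall j, [set` `[lo, hi]] (x ord0 j)].
  by apply/seteqP; split=> x /= xb j; move: (xb j); rewrite in_itv.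
exact: (@rV_compact R 4 _ (fun=> @segment_compact R lo hi)).
Qed.

Section IntegerPart.
Context {R : realType}.

Lemma int_norm_lt1 (z : R) : z \is a Num.int -> `|z| < 1 -> z = 0.
Proof.
move=> /intrP[m ->]; rewrite -intr_norm -[1]/(1%:~R) ltr_int => m1.
by have -> : m = 0 by lia.
Qed.

(** The integer whose addition leaves the fractional part of [z]. *)
Definition frac_shift (z : R) : R := - (Num.floor z)%:~R.

Lemma frac_shift_itv z : 0 <= z + frac_shift z <= 1.
Proof.
have /andP[h1 h2] := floor_itv z.
by rewrite /frac_shift; move: h1 h2; rewrite intrD => h1 h2; lra.
Qed.

End IntegerPart.

(** * The Heisenberg group times a line, and its integer lattice *)

Section Heisenberg.
Context {R : realType}.
Implicit Types x y : 'rV[R]_4.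

Let o0 : 'I_4 := inord 0. Let o1 : 'I_4 := inord 1.
Let o2 : 'I_4 := inord 2. Let o3 : 'I_4 := inord 3.

(** Product of unipotent upper triangular matrices of size 3: coordinates 0 and 1 lie above the
    diagonal, coordinate 2 in the corner. Coordinate 3 is the additional line. *)
Definition heis_mul x y : 'rV[R]_4 :=
  row4 (x 0 o0 + y 0 o0) (x 0 o1 + y 0 o1)
    (x 0 o2 + y 0 o2 + x 0 o0 * y 0 o1) (x 0 o3 + y 0 o3).

Definition heis_inv x : 'rV[R]_4 :=
  row4 (- x 0 o0) (- x 0 o1) (- x 0 o2 + x 0 o0 * x 0 o1) (- x 0 o3).

Lemma heis_mulA : associative heis_mul.
Proof. by move=> x y z; apply: row4P; rewrite /heis_mul !row4E; ring. Qed.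

Lemma heis_mul1 : left_id 0 heis_mul.
Proof. by move=> x; apply: row4P; rewrite /heis_mul !row4E !mxE; ring. Qed.

Lemma heis_mulV : left_inverse 0 heis_inv heis_mul.
Proof.
by move=> x; apply: row4P; rewrite /heis_mul /heis_inv !row4E ?mxE; ring.
Qed.

Lemma heis_smooth_mul : smooth (fun p : 'rV[R]_4 * 'rV[R]_4 => heis_mul p.1 p.2).
Proof.
have tf := trig_poly_fst; have ts := trig_poly_snd.
apply: smooth_row4; try by apply: trig_poly_add.
apply: trig_poly_add; first exact: trig_poly_add.
exact: trig_poly_mul.
Qed.

Lemma heis_smooth_inv : smooth heis_inv.
Proof.
have tc := trig_poly_coord.
apply: smooth_row4; try by apply: trig_poly_opp.
apply: trig_poly_add; first exact: trig_poly_opp.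
exact: trig_poly_mul.
Qed.

Definition heis_group : @lieGroup R 3 :=
  LieGroup heis_mulA heis_mul1 heis_mulV heis_smooth_mul heis_smooth_inv.

Lemma heis_left_inv_field (v p : 'rV[R]_4) :
  left_inv_field heis_group v p =
  row4 (v 0 o0) (v 0 o1) (v 0 o2 + p 0 o0 * v 0 o1) (v 0 o3).
Proof.
by apply: derive_row4; apply: is_derive_affine => h; rewrite !mxE; ring.
Qed.

Lemma heis_bracket (u v : 'rV[R]_4) :
  lg_bracket heis_group u v =
  row4 0 0 (u 0 o0 * v 0 o1 - u 0 o1 * v 0 o0) 0.
Proof.
have D (a b : 'rV[R]_4) : 'D_a (left_inv_field heis_group b) 0 =
    row4 0 0 (a 0 o0 * b 0 o1) 0.
  rewrite (funext (heis_left_inv_field b)).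
  by apply: derive_row4; apply: is_derive_affine => h; rewrite ?mxE; ring.
by rewrite /lg_bracket /= !D; apply: row4P; rewrite !mxE !inordK //=; ring.
Qed.

Lemma heis_int_one j : (0 : 'rV[R]_4) 0 j \is a Num.int.
Proof. by rewrite mxE. Qed.

Definition int_point : set 'rV[R]_4 := [set x | forall j, x 0 j \is a Num.int].

Lemma heis_lattice_mul x y :
  int_point x -> int_point y -> int_point (heis_mul x y).
Proof. by move=> xi yi; apply: ord4_ind; rewrite row4E !(rpredD, rpredM). Qed.

Lemma heis_lattice_inv x : int_point x -> int_point (heis_inv x).
Proof. by move=> xi; apply: ord4_ind; rewrite row4E !(rpredD, rpredM, rpredN). Qed.

Definition heis_lattice : subgroup heis_group :=
  @Subgroup _ _ heis_group int_point heis_int_one heis_lattice_mul heis_lattice_inv.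

Lemma heis_latticeP : lattice heis_lattice.
Proof.
split.
  apply: separated_discrete => x y xi yi xy; apply/rowP => j; apply/eqP.
  rewrite -subr_eq0; apply/eqP/int_norm_lt1 => //.
  by rewrite rpredB.
apply: (compact_coset_space (@box_compact R 0 1)).
move=> x; pose l1 := frac_shift (x 0 o1); pose l0 := frac_shift (x 0 o0).
have si z : frac_shift z \is a Num.int by rewrite rpredN intr_int.
(* Right multiplication also adds [x 0 o0 * l1] to the corner entry, so the corner shift is chosen
   after [l1]. *)
exists (row4 l0 l1 (frac_shift (x 0 o2 + x 0 o0 * l1)) (frac_shift (x 0 o3))).
  by apply: ord4_ind; rewrite row4E; exact: si.
apply: ord4_ind; rewrite /= /heis_mul !row4E;
  rewrite ?frac_shift_itv //.
by rewrite addrAC frac_shift_itv.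
Qed.

End Heisenberg.

Lemma A31_A1_compact_quotients (R : realType) :
  admits_compact_quotients (@A31_A1 R).
Proof.
exists 3%N, heis_group; split; last first.
  by exists heis_lattice; exact: heis_latticeP.
exists \1%VF; split; first by exists id => x; rewrite lfunE.
by move=> x y; rewrite !lfunE /= A31_A1E heis_bracket.
Qed.

(** * The universal cover of the plane motions times a line, and a lattice in it *)

Section Euclid.
Context {R : realType}.
Implicit Types x y : 'rV[R]_4.

Let o0 : 'I_4 := inord 0. Let o1 : 'I_4 := inord 1.
Let o2 : 'I_4 := inord 2. Let o3 : 'I_4 := inord 3.

(** Coordinates 0 and 1 are the translation part, coordinate 2 is the angle kept as a real number,
    coordinate 3 is the additional line. *)
Definition rot_mul x y : 'rV[R]_4 :=
  row4 (x 0 o0 + cos (x 0 o2) * y 0 o0 - sin (x 0 o2) * y 0 o1)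
    (x 0 o1 + sin (x 0 o2) * y 0 o0 + cos (x 0 o2) * y 0 o1)
    (x 0 o2 + y 0 o2) (x 0 o3 + y 0 o3).

Definition rot_inv x : 'rV[R]_4 :=
  row4 (- (cos (x 0 o2) * x 0 o0 + sin (x 0 o2) * x 0 o1))
    (sin (x 0 o2) * x 0 o0 - cos (x 0 o2) * x 0 o1) (- x 0 o2) (- x 0 o3).

Lemma rot_mulA : associative rot_mul.
Proof.
by move=> x y z; apply: row4P; rewrite /rot_mul !row4E ?cosD ?sinD; ring.
Qed.

Lemma rot_mul1 : left_id 0 rot_mul.
Proof.
by move=> x; apply: row4P; rewrite /rot_mul !row4E !mxE ?cos0 ?sin0; ring.
Qed.

Lemma rot_mulV : left_inverse 0 rot_inv rot_mul.
Proof.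
by move=> x; apply: row4P; rewrite /rot_mul /rot_inv !row4E !mxE ?cosN ?sinN;
  ring.
Qed.

Lemma rot_smooth_mul : smooth (fun p : 'rV[R]_4 * 'rV[R]_4 => rot_mul p.1 p.2).
Proof.
have tf := trig_poly_fst; have ts := trig_poly_snd.
have tc := trig_poly_cos (tf R o2); have tn := trig_poly_sin (tf R o2).
apply: smooth_row4; last 2 first.
- exact: trig_poly_add.
- exact: trig_poly_add.
- apply: trig_poly_add; last by apply/trig_poly_opp/trig_poly_mul.
  by apply: trig_poly_add => //; exact: trig_poly_mul.
- apply: trig_poly_add; last exact: trig_poly_mul.
  by apply: trig_poly_add => //; exact: trig_poly_mul.
Qed.

Lemma rot_smooth_inv : smooth rot_inv.
Proof.
have tx := @trig_poly_coord R.
have tc := trig_poly_cos (tx o2); have tn := trig_poly_sin (tx o2).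
apply: smooth_row4; last 2 first.
- exact: trig_poly_opp.
- exact: trig_poly_opp.
- by apply/trig_poly_opp/trig_poly_add; exact: trig_poly_mul.
- apply: trig_poly_add; first exact: trig_poly_mul.
  by apply/trig_poly_opp/trig_poly_mul.
Qed.

Definition rot_group : @lieGroup R 3 :=
  LieGroup rot_mulA rot_mul1 rot_mulV rot_smooth_mul rot_smooth_inv.

Lemma rot_left_inv_field (v p : 'rV[R]_4) :
  left_inv_field rot_group v p =
  row4 (cos (p 0 o2) * v 0 o0 - sin (p 0 o2) * v 0 o1)
    (sin (p 0 o2) * v 0 o0 + cos (p 0 o2) * v 0 o1) (v 0 o2) (v 0 o3).
Proof.
by apply: derive_row4; apply: is_derive_affine => h; rewrite !mxE; ring.
Qed.

(** At angle 0 the cosine has slope 0 and the sine slope 1, so only [s] contributes. The origin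
    suffices because the bracket is taken at the identity. *)
Lemma is_derive_rot (c s : R) (a : 'rV[R]_4) :
  is_derive (0 : 'rV[R]_4) a (fun p : 'rV[R]_4 => cos (p 0 o2) * c + sin (p 0 o2) * s)
    (s * a 0 o2).
Proof.
have dp := is_diff_coord o2 (0 : 'rV[R]_4).
have dc := is_diff_comp dp (is_diff_cos _).
have ds := is_diff_comp dp (is_diff_sin _).
have d := is_diffD (is_diffZ c dc) (is_diffZ s ds).
have -> : (fun p : 'rV[R]_4 => cos (p 0 o2) * c + sin (p 0 o2) * s) =
    c *: (cos \o (fun p : 'rV[R]_4 => p 0 o2))
    + s *: (sin \o (fun p : 'rV[R]_4 => p 0 o2)).
  by apply/funext => p; rewrite ![_ * c]mulrC ![_ * s]mulrC.
apply: DeriveDef; first by apply: diff_derivable; case: d.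
rewrite deriveE; last by case: d.
rewrite diff_val; rewrite !fctE /= mxE cos0 sin0 /GRing.scale /=; ring.
Qed.

Lemma rot_bracket (u v : 'rV[R]_4) :
  lg_bracket rot_group u v =
  row4 (u 0 o1 * v 0 o2 - u 0 o2 * v 0 o1) (u 0 o2 * v 0 o0 - u 0 o0 * v 0 o2) 0 0.
Proof.
have D (a b : 'rV[R]_4) : 'D_a (left_inv_field rot_group b) 0 =
    row4 (- b 0 o1 * a 0 o2) (b 0 o0 * a 0 o2) 0 0.
  rewrite (funext (rot_left_inv_field b)).
  apply: derive_row4.
  - by under eq_fun do rewrite -mulrN; exact: is_derive_rot.
  - by under eq_fun do rewrite addrC; exact: is_derive_rot.
by rewrite /lg_bracket /= !D; apply: row4P; rewrite !mxE !inordK //=; ring.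
Qed.

(* [cos t = 1] and [sin t = 0] say that [t] is in [2 pi Z]. *)
Definition rot_points : set 'rV[R]_4 := [set x | [/\ x 0 o0 \is a Num.int,
  x 0 o1 \is a Num.int, cos (x 0 o2) = 1, sin (x 0 o2) = 0 & x 0 o3 \is a Num.int]].

Lemma rot_points_one : rot_points 0.
Proof. by split; rewrite mxE ?cos0 ?sin0. Qed.

(** The rotation part of these points is trivial, so the group law reduces to addition on them. *)
Lemma rot_points_mul x y :
  rot_points x -> rot_points y -> rot_points (rot_mul x y).
Proof.
move=> [x0 x1 cx sx x3] [y0 y1 cy sy y3].
by split; rewrite row4E ?cosD ?sinD ?cx ?sx ?cy ?sy ?(mul1r, mul0r, mulr0)
  ?(addr0, subr0) // rpredD.
Qed.

Lemma rot_points_inv x : rot_points x -> rot_points (rot_inv x).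
Proof.
move=> [x0 x1 cx sx x3].
by split; rewrite row4E ?cosN ?sinN ?cx ?sx ?oppr0 ?mul0r ?mul1r ?sub0r ?addr0
  ?rpredN.
Qed.

Definition rot_lattice : subgroup rot_group :=
  @Subgroup _ _ rot_group rot_points rot_points_one rot_points_mul rot_points_inv.

(** By parity one may pass to the absolute value, which lies in the interval from 0 to pi where
    cosine is injective. *)
Lemma cos_eq1_small (t : R) : `|t| < 1 -> cos t = 1 -> t = 0.
Proof.
move=> t1 ct; apply/normr0_eq0/(@cos_inj R).
- rewrite in_itv /= normr_ge0 /= (le_trans (ltW t1)) // (le_trans _ (pi_ge2 R)) //.
  by rewrite ler1n.
- by rewrite in_itv /= lexx pi_ge0.
- by rewrite cos0 cos_norm.
Qed.

Lemma rot_lattice_discrete : discrete_subgroup rot_lattice.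
Proof.
apply: separated_discrete => x y [x0 x1 cx sx x3] [y0 y1 cy sy y3] xy.
have eqi i : x 0 i \is a Num.int -> y 0 i \is a Num.int -> x 0 i = y 0 i.
  move=> xi yi; apply/eqP; rewrite -subr_eq0; apply/eqP/int_norm_lt1 => //.
  by rewrite rpredB.
apply: row4P; [exact: eqi|exact: eqi| |exact: eqi].
apply/eqP; rewrite -subr_eq0; apply/eqP/cos_eq1_small => //.
by rewrite cosB cx cy sx sy; ring.
Qed.

Lemma period_shift (t : R) :
  exists2 s, cos s = 1 /\ sin s = 0 & 0 <= t + s <= pi *+ 2.
Proof.
have pi2 : 0 < (pi : R) *+ 2 by rewrite pmulrn_lgt0 // pi_gt0.
have period n : cos (pi *+ 2 *+ n : R) = 1 /\ sin (pi *+ 2 *+ n : R) = 0.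
  rewrite -[pi *+ 2 *+ n]add0r (periodicn (@cosD2pi R)) (periodicn (@sinD2pi R)).
  by rewrite cos0 sin0.
exists (frac_shift (t / (pi *+ 2)) * (pi *+ 2)).
  rewrite /frac_shift mulNr cosN sinN mulrC mulrzr.
  (* [period] treats natural multiples of 2 pi; a negative floor is reduced to it by parity. *)
  case: (Num.floor _) => n.
    by rewrite -pmulrn; have [-> ->] := period n; rewrite oppr0.
  rewrite NegzE mulrNz -pmulrn cosN sinN.
  by have [-> ->] := period n.+1; rewrite !oppr0.
have /andP[h0 h1] := frac_shift_itv (t / (pi *+ 2)).
have tE : t = t / (pi *+ 2) * (pi *+ 2) by rewrite divfK // gt_eqF.
rewrite [X in X + _]tE -mulrDl; apply/andP; split; first by rewrite mulr_ge0 // ltW.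
by rewrite ler_piMl // ltW.
Qed.

Lemma rot_latticeP : lattice rot_lattice.
Proof.
split; first exact: rot_lattice_discrete.
(* The bound 2 pi serves the angle, and 2 a rotated point of the unit square. *)
pose B : R := pi *+ 2 + 2.
have pi0 : 0 <= (pi : R) by exact: pi_ge0.
apply: (compact_coset_space (@box_compact R (- B) B)) => x.
have [s [cs ss] sB] := period_shift (x 0 o2).
set c := cos (x 0 o2); set d := sin (x 0 o2).
(* With Q the rotation by the angle of [x], the plane part of the product is Q applied to the
   inverse rotation of [x] plus [l]. Hence [l0] and [l1] bring this inverse rotation into the unit
   square. *)
pose l0 := frac_shift (c * x 0 o0 + d * x 0 o1).
pose l1 := frac_shift (c * x 0 o1 - d * x 0 o0).
have si z : frac_shift z \is a Num.int by rewrite rpredN intr_int.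
exists (row4 l0 l1 s (frac_shift (x 0 o3))).
  by split; rewrite row4E ?cs ?ss //; exact: si.
have /andP[u0 u1] : 0 <= c * x 0 o0 + d * x 0 o1 + l0 <= 1 by exact: frac_shift_itv.
have /andP[w0 w1] : 0 <= c * x 0 o1 - d * x 0 o0 + l1 <= 1 by exact: frac_shift_itv.
have cd : c ^+ 2 + d ^+ 2 = 1 by exact: cos2Dsin2.
have /andP[c0 c1] : -1 <= c <= 1 by rewrite cos_geN1 cos_le1.
have /andP[d0 d1] : -1 <= d <= 1 by rewrite sin_geN1 sin_le1.
have /andP[z0 z1] := frac_shift_itv (x 0 o3).
have bound (p q u w : R) : -1 <= p -> p <= 1 -> -1 <= q -> q <= 1 -> 0 <= u -> u <= 1 ->
    0 <= w -> w <= 1 -> -2 <= p * u + q * w <= 2.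
  by move=> *; apply/andP; split; nra.
apply: ord4_ind; rewrite /= /rot_mul !row4E -/c -/d.
- have := bound c (- d) _ _ c0 c1 _ _ u0 u1 w0 w1.
  (* The last summand vanishes since [c ^+ 2 + d ^+ 2 = 1]; it turns the factorization through Q
     into a polynomial identity. *)
  have -> : x 0 o0 + c * l0 - d * l1 = c * (c * x 0 o0 + d * x 0 o1 + l0) +
    - d * (c * x 0 o1 - d * x 0 o0 + l1) + (1 - (c ^+ 2 + d ^+ 2)) * x 0 o0 by ring.
  rewrite cd subrr mul0r addr0 => b; have := b ltac:(lra) ltac:(lra); rewrite /B; lra.
- have := bound d c _ _ d0 d1 c0 c1 u0 u1 w0 w1.
  have -> : x 0 o1 + d * l0 + c * l1 = d * (c * x 0 o0 + d * x 0 o1 + l0) +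
    c * (c * x 0 o1 - d * x 0 o0 + l1) + (1 - (c ^+ 2 + d ^+ 2)) * x 0 o1 by ring.
  by rewrite cd subrr mul0r addr0 /B; lra.
- by rewrite /B; lra.
- by rewrite /B; lra.
Qed.

End Euclid.

Lemma A36_A1_compact_quotients (R : realType) :
  admits_compact_quotients (@A36_A1 R).
Proof.
exists 3%N, rot_group; split; last first.
  by exists rot_lattice; exact: rot_latticeP.
exists \1%VF; split; first by exists id => x; rewrite lfunE.
by move=> x y; rewrite !lfunE /= A36_A1E rot_bracket.
Qed.

(** * Curvature in an adapted frame *)

Section Frame.
Context {R : realType} {g : vectType R}.
Context (lb : {bilinear g -> g -> g}) (ip : {dot g for idfun}) (J : 'End(g)).
Context (e : 4.-tuple g).
Hypothesis frame : orthonormal_frame ip e.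

Lemma ipC x y : ip x y = ip y x.
Proof. by rewrite hermC /= expr0 mul1r. Qed.

Lemma ipDl x y z : ip (x + y) z = ip x z + ip y z. Proof. exact: linearDl. Qed.
Lemma ipNl x y : ip (- x) y = - ip x y. Proof. exact: linearNl. Qed.
Lemma ipZl c x y : ip (c *: x) y = c * ip x y. Proof. exact: linearZl_LR. Qed.
Lemma ip0l x : ip 0 x = 0. Proof. exact: linear0l. Qed.
Lemma ipNr x y : ip x (- y) = - ip x y. Proof. exact: linearNr. Qed.

Lemma ip_frame i j : (i < 4)%N -> (j < 4)%N -> ip e`_i e`_j = (i == j)%:R.
Proof. by move=> i4 j4; have [_ /(_ (Ordinal i4) (Ordinal j4))] := frame. Qed.

Lemma frame_decomp x :
  x = ip x e`_0 *: e`_0 + ip x e`_1 *: e`_1 + ip x e`_2 *: e`_2 + ip x e`_3 *: e`_3.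
Proof.
have [be _] := frame.
have xE := coord_basis be (memvf x).
have cE (i : 'I_4) : ip x e`_i = coord e i x.
  rewrite [in LHS]xE sum_ord4 !ipDl !ipZl; move: i.
  by apply: ord4_ind; rewrite !inordK // !ip_frame //=; ring.
by rewrite [LHS]xE sum_ord4 -!cE !inordK.
Qed.

Lemma frame_ext x y : (forall i : 'I_4, ip x e`_i = ip y e`_i) -> x = y.
Proof.
move=> xy; rewrite [x]frame_decomp [y]frame_decomp.
have xy' k : (k < 4)%N -> ip x e`_k = ip y e`_k by move=> k4; exact: (xy (Ordinal k4)).
by rewrite !xy'.
Qed.

(** Basis independence of the trace: expanding the argument of [f] over the frame, and the image of
    each frame vector over [vbasis], yields the same double sum. *)
Lemma endo_trace_frame (f : {linear g -> g}) :
  endo_trace f = \sum_(i < 4) ip (f e`_i) e`_i.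
Proof.
have bX := vbasisP {:g}.
have fE x : f x = \sum_(j < 4) ip x e`_j *: f e`_j.
  by rewrite {1}[x]frame_decomp !linearD !linearZ sum_ord4 !inordK.
rewrite /endo_trace; under eq_bigr do rewrite fE linear_sum.
rewrite exchange_big /=; apply: eq_bigr => j _.
rewrite [in RHS](coord_basis bX (memvf (f e`_j))) linear_sumlz /=.
by apply: eq_bigr => i _; rewrite linearZ ipZl mulrC.
Qed.

Lemma frame_expand (f : g -> R) x :
  (forall y z, f (y + z) = f y + f z) -> (forall c y, f (c *: y) = c * f y) ->
  f x = ip x e`_0 * f e`_0 + ip x e`_1 * f e`_1 + ip x e`_2 * f e`_2
    + ip x e`_3 * f e`_3.
Proof. by move=> fD fZ; rewrite [in LHS](frame_decomp x) !(fD, fZ). Qed.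

Lemma frame_expand_ip y x : ip x y =
  ip x e`_0 * ip y e`_0 + ip x e`_1 * ip y e`_1 + ip x e`_2 * ip y e`_2
    + ip x e`_3 * ip y e`_3.
Proof.
rewrite (@frame_expand (ip^~ y)); first by rewrite !(ipC y).
  by move=> u w; exact: ipDl.
by move=> c u; exact: ipZl.
Qed.

Lemma frame_expand2 (f : {bilinear g -> g -> g}) x y w : ip (f x y) w =
  ip x e`_0 * ip (f e`_0 y) w + ip x e`_1 * ip (f e`_1 y) w
    + ip x e`_2 * ip (f e`_2 y) w + ip x e`_3 * ip (f e`_3 y) w.
Proof.
apply: (@frame_expand (fun x => ip (f x y) w)) => [u z|c u].
  by rewrite linearDl ipDl.
by rewrite linearZl_LR ipZl.
Qed.

Lemma frame_expand2r (f : {bilinear g -> g -> g}) x y w : ip (f x y) w =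
  ip y e`_0 * ip (f x e`_0) w + ip y e`_1 * ip (f x e`_1) w
    + ip y e`_2 * ip (f x e`_2) w + ip y e`_3 * ip (f x e`_3) w.
Proof.
apply: (@frame_expand (fun y => ip (f x y) w)) => [u z|c u].
  by rewrite linearDr ipDl.
by rewrite linearZr_LR ipZl.
Qed.

(** * Hermitian connections in a unitary frame *)

Section Complex.
Hypothesis herm : almost_hermitian ip J.
Hypotheses (J0 : J e`_0 = e`_3) (J1 : J e`_1 = e`_2).

Lemma J_frame2 : J e`_2 = - e`_1. Proof. by rewrite -J1 herm.1. Qed.
Lemma J_frame3 : J e`_3 = - e`_0. Proof. by rewrite -J0 herm.1. Qed.

Lemma ip_Jl x y : ip (J x) y = - ip x (J y).
Proof. by rewrite -[y in LHS]opprK -[- y]herm.1 ipNr herm.2. Qed.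

Lemma coord_J x : ((ip (J x) e`_0 = - ip x e`_3) * (ip (J x) e`_1 = - ip x e`_2) *
  (ip (J x) e`_2 = ip x e`_1) * (ip (J x) e`_3 = ip x e`_0))%type.
Proof. by rewrite !ip_Jl J0 J1 J_frame2 J_frame3 !ipNr !opprK. Qed.

Lemma fund_formE x y : fund_form ip J x y =
  ip x e`_0 * ip y e`_3 - ip x e`_3 * ip y e`_0
  + ip x e`_1 * ip y e`_2 - ip x e`_2 * ip y e`_1.
Proof.
by rewrite /fund_form frame_expand_ip !coord_J; ring.
Qed.

(** Inner products of left-invariant fields are constant, so only the bracket terms of Koszul's
    formula remain. *)
Lemma koszul (D : {bilinear g -> g -> g}) x y z : levi_civita lb ip D ->
  2 * ip (D x y) z = ip (lb x y) z - ip (lb y z) x + ip (lb z x) y.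
Proof.
move=> [met tors].
have tE u w t : ip (lb u w) t = ip (D u w) t - ip (D w u) t.
  have /eqP := tors u w; rewrite subr_eq0 => /eqP <-.
  by rewrite ipDl ipNl.
have mE u w t : ip (D u w) t = - ip (D u t) w.
  by apply/eqP; rewrite -addr_eq0 (ipC _ w) met.
rewrite !tE (mE x z y) (mE y z x) (mE z y x); ring.
Qed.

(* Traces the identity [T(z, J u) = T(J z, u)] over the frame. *)
Lemma chern_trace (C : {bilinear g -> g -> g}) z : chern_conn lb ip J C ->
  2 * (ip (C z e`_0) e`_3 + ip (C z e`_1) e`_2) =
  ip (lb z e`_0) e`_3 + ip (lb z e`_1) e`_2 - ip (lb z e`_2) e`_1
  - ip (lb z e`_3) e`_0 + \sum_(i < 4) ip (lb (J z) e`_i) e`_i.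
Proof.
move=> [met comJ tors].
(* Apply the Chern torsion condition to [z] and [J u], and use [J (J u) = - u]. *)
have tE u : torsion lb C z (J u) = torsion lb C (J z) u.
  rewrite -[LHS]opprK -tors herm.1 /torsion !linearNr !linearNl /=.
  by rewrite !opprD !opprK.
have CJ u w : C u (J w) = J (C u w).
  by apply/eqP; rewrite -subr_eq0; apply/eqP; exact: comJ.
have mE u w t : ip (C u w) t = - ip (C u t) w.
  by apply/eqP; rewrite -addr_eq0 (ipC _ w) met.
have m0 u w : ip (C u w) w = 0 by have := mE u w w; lra.
have tip u w := congr1 (ip^~ w) (tE u).
move: (tip e`_0 e`_0) (tip e`_1 e`_1) (tip e`_2 e`_2) (tip e`_3 e`_3).
rewrite /torsion J0 J1 J_frame2 J_frame3 !linearNr !linearNl /= !(ipDl, ipNl).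
(* Skewness removes the terms in [C (J z)]; once [J] is pulled out, the terms differentiating [z]
   cancel in the trace. *)
rewrite !(CJ _ z) !coord_J !m0.
rewrite (mE z e`_3 e`_0) (mE z e`_2 e`_1) sum_ord4 !inordK //.
lra.
Qed.

(** With [J] as multiplication by i, both maps lie in u(2), and the sum is twice the imaginary part
    of the complex trace of their commutator. *)
Lemma unitary_commutator_trace (X Y : {linear g -> g}) :
  (forall u w, ip (X u) w = - ip (X w) u) -> (forall u, X (J u) = J (X u)) ->
  (forall u w, ip (Y u) w = - ip (Y w) u) -> (forall u, Y (J u) = J (Y u)) ->
  \sum_(i < 4) ip (X (Y e`_i) - Y (X e`_i)) (J e`_i) = 0.
Proof.
move=> sX JX sY JY.
have expand (Z : {linear g -> g}) u w : ip (Z u) w = ip u e`_0 * ip (Z e`_0) w +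
    ip u e`_1 * ip (Z e`_1) w + ip u e`_2 * ip (Z e`_2) w + ip u e`_3 * ip (Z e`_3) w.
  apply: (@frame_expand (fun u => ip (Z u) w)) => [t t'|c t].
    by rewrite linearD ipDl.
  by rewrite linearZ ipZl.
(* These relations leave the four real parameters of u(2). *)
have red (Z : {linear g -> g}) : (forall u w, ip (Z u) w = - ip (Z w) u) ->
    (forall u, Z (J u) = J (Z u)) ->
    [/\ Z e`_3 = J (Z e`_0), Z e`_2 = J (Z e`_1), ip (Z e`_0) e`_0 = 0,
      ip (Z e`_1) e`_1 = 0 & ip (Z e`_1) e`_0 = - ip (Z e`_0) e`_1 /\
      ip (Z e`_1) e`_3 = ip (Z e`_0) e`_2].
  move=> sZ JZ; have z0 := sZ e`_0 e`_0; have z1 := sZ e`_1 e`_1.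
  split; rewrite -?J0 -?J1 ?JZ //; [lra|lra|split=> //].
  by rewrite J0 J1 sZ -J0 JZ coord_J opprK.
have [X3 X2 X00 X11 [X10 X13]] := red X sX JX.
have [Y3 Y2 Y00 Y11 [Y10 Y13]] := red Y sY JY.
rewrite sum_ord4 !inordK // J0 J1 J_frame2 J_frame3 !(ipNr, ipDl, ipNl).
rewrite !(expand X (Y _)) !(expand Y (X _)) X3 X2 Y3 Y2 !coord_J.
rewrite X00 X11 X10 X13 Y00 Y11 Y10 Y13; ring.
Qed.

(** * The Bismut connection and its Ricci form *)

Section Bismut.
Context (D C : {bilinear g -> g -> g}) (B : g -> g -> g).
Hypothesis lcD : levi_civita lb ip D.
Hypothesis chC : chern_conn lb ip J C.
Hypothesis BE : forall x y, B x y = 2 *: nabla0 D J x y - C x y.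

(** Twice [nabla0 D J x y] is [D x y - J (D x (J y))], that is, twice the [J]-linear part of
    [D x]. *)
Lemma ip_bismut x y w :
  ip (B x y) w = ip (D x y) w + ip (D x (J y)) (J w) - ip (C x y) w.
Proof.
rewrite BE /nabla0 /cov_J (linearB J) /= herm.1 opprK !(ipDl, ipNl, ipZl) ip_Jl.
by field.
Qed.

(** [B] is known only through its pointwise formula; linearity lets [B x] be packed as a linear map
    for the commutator trace. *)
Lemma bismut_linear x : linear (B x).
Proof.
move=> c y z; apply: frame_ext => i; rewrite ipDl ipZl !ip_bismut.
by rewrite (linearP J) !(linearPr D) !(linearPr C) /= !(ipDl, ipZl); ring.
Qed.

Lemma bismut_skew x y w : ip (B x y) w = - ip (B x w) y.
Proof.
have [mD _] := lcD; have [mC _ _] := chC.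
have sD u t s : ip (D u t) s = - ip (D u s) t.
  by apply/eqP; rewrite -addr_eq0 (ipC _ t) mD.
have sC u t s : ip (C u t) s = - ip (C u s) t.
  by apply/eqP; rewrite -addr_eq0 (ipC _ t) mC.
by rewrite !ip_bismut (sD x w y) (sC x w y) (sD x (J w) (J y)); ring.
Qed.

Lemma bismut_J x y : B x (J y) = J (B x y).
Proof.
have [_ cJ _] := chC.
have CJ : C x (J y) = J (C x y).
  by apply/eqP; rewrite -subr_eq0; apply/eqP; exact: cJ.
apply: frame_ext => i; rewrite ip_Jl !ip_bismut herm.1 CJ !herm.1 linearNr.
by rewrite !(ipNl, ipNr) ip_Jl; ring.
Qed.

(** [B x] and [B y] lie in u(2), so their commutator has no trace and only the bracket term of the
    curvature remains. Skewness pairs its four summands, which absorbs the factor one half. *)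
Lemma bismut_ric x y :
  ric_form lb ip J e B x y = ip (B (lb x y) e`_0) e`_3 + ip (B (lb x y) e`_1) e`_2.
Proof.
pose lin u := GRing.isLinear.Build _ _ _ _ _ (bismut_linear u).
pose L u : {linear g -> g} := HB.pack (B u) (lin u).
have := @unitary_commutator_trace (L x) (L y) (bismut_skew x) (bismut_J x)
  (bismut_skew y) (bismut_J y).
rewrite /ric_form /curvature !sum_ord4 !inordK // J0 J1 J_frame2 J_frame3 /=.
set z := lb x y; rewrite !(ipDl, ipNr, ipNl).
rewrite (bismut_skew z e`_2) (bismut_skew z e`_3); lra.
Qed.

End Bismut.

(** * The bracket, [dF] and the Bismut-Einstein equation in terms of [b], [v] and [al] *)

Section Bracket.
Context (a b1 b2 v1 v2 al : R).
Hypothesis lb_alt : forall x, lb x x = 0.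
Hypotheses (lb01 : lb e`_0 e`_1 = 0) (lb02 : lb e`_0 e`_2 = 0)
  (lb12 : lb e`_1 e`_2 = 0).
Hypothesis lb30 : lb e`_3 e`_0 = a *: e`_0 + (v1 *: e`_1 + v2 *: e`_2).
Hypothesis lb31 : lb e`_3 e`_1 = b1 *: e`_0 + al *: e`_2.
Hypothesis lb32 : lb e`_3 e`_2 = b2 *: e`_0 - al *: e`_1.

Lemma lb_skew x y : lb x y = - lb y x.
Proof.
apply/eqP; rewrite -addr_eq0; apply/eqP.
by have := lb_alt (x + y); rewrite linearDl !linearDr /= !lb_alt add0r addr0 addrC.
Qed.

Lemma unimodular_frame : unimodular lb -> a = 0.
Proof.
move=> /(_ e`_3); rewrite (endo_trace_frame (lb e`_3)) sum_ord4 !inordK //= lb_alt.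
rewrite lb30 lb31 lb32 !(ipDl, ipNl, ipZl, ip0l) !ip_frame //=.
lra.
Qed.

(** As the ideal is abelian, [x, y] = x_4 M y - y_4 M x, where M acts on the components in the
    ideal. *)
Lemma coord_lb x y :
  ((ip (lb x y) e`_0 = a * (ip x e`_3 * ip y e`_0 - ip x e`_0 * ip y e`_3)
      + b1 * (ip x e`_3 * ip y e`_1 - ip x e`_1 * ip y e`_3)
      + b2 * (ip x e`_3 * ip y e`_2 - ip x e`_2 * ip y e`_3))%R *
  (ip (lb x y) e`_1 = v1 * (ip x e`_3 * ip y e`_0 - ip x e`_0 * ip y e`_3)
      - al * (ip x e`_3 * ip y e`_2 - ip x e`_2 * ip y e`_3))%R *
  (ip (lb x y) e`_2 = v2 * (ip x e`_3 * ip y e`_0 - ip x e`_0 * ip y e`_3)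
      + al * (ip x e`_3 * ip y e`_1 - ip x e`_1 * ip y e`_3))%R *
  (ip (lb x y) e`_3 = 0))%type.
Proof.
have lb10 : lb e`_1 e`_0 = 0 by rewrite lb_skew lb01 oppr0.
have lb20 : lb e`_2 e`_0 = 0 by rewrite lb_skew lb02 oppr0.
have lb21 : lb e`_2 e`_1 = 0 by rewrite lb_skew lb12 oppr0.
have lb03 := lb_skew e`_0 e`_3; have lb13 := lb_skew e`_1 e`_3.
have lb23 := lb_skew e`_2 e`_3.
by do !split; rewrite frame_expand2 !(frame_expand2r lb _ y) lb03 lb13 lb23 lb30
  lb31 lb32 lb01 lb02 lb12 lb10 lb20 lb21 !lb_alt !(ipNl, ipDl, ipZl, ip0l)
  !ip_frame //=; ring.
Qed.

Hypothesis a0 : a = 0.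

(** In F = e^1 wedge e^4 + e^2 wedge e^3, the form d e^1 carries a factor e^4, which kills the terms
    in [b]. The rotation preserves e^2 wedge e^3, so only [v] survives. *)
Lemma dF_frame x y z : dF lb ip J x y z =
  - ((ip x e`_3 * ip y e`_0 - ip x e`_0 * ip y e`_3) * (v1 * ip z e`_2 - v2 * ip z e`_1)
  - (ip x e`_3 * ip z e`_0 - ip x e`_0 * ip z e`_3) * (v1 * ip y e`_2 - v2 * ip y e`_1)
  + (ip y e`_3 * ip z e`_0 - ip y e`_0 * ip z e`_3) * (v1 * ip x e`_2 - v2 * ip x e`_1)).
Proof. by rewrite /dF /ext_d2 !fund_formE !coord_lb a0; ring. Qed.

(** An instance of a general fact: on a unimodular Lie algebra of dimension 4 every left-invariant
    3-form is closed. *)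
Lemma dJdF_frame x y z t : ext_d3 lb (JdF lb ip J) x y z t = 0.
Proof. by rewrite /ext_d3 /JdF !dF_frame !coord_J !coord_lb a0; ring. Qed.

Lemma almost_kahler_frame : almost_kahler lb ip J <-> v1 = 0 /\ v2 = 0.
Proof.
split=> [ak|[v10 v20] x y z]; last by rewrite dF_frame v10 v20; ring.
have := ak e`_0 e`_3 e`_1; have := ak e`_0 e`_3 e`_2.
by rewrite !dF_frame !ip_frame //=; split; lra.
Qed.

(** Here M kills e_1 and rotates n_1, hence commutes with [J] there. This identifies the Kähler
    case. *)
Lemma integrable_frame : b1 = 0 -> b2 = 0 -> v1 = 0 -> v2 = 0 -> integrable_acs lb J.
Proof.
move=> b10 b20 v10 v20 x y; apply: frame_ext; apply: ord4_ind; rewrite inordK //;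
  by rewrite !(ipDl, ipNl) !coord_J !coord_lb !coord_J
    ?a0 ?b10 ?b20 ?v10 ?v20 ip0l; ring.
Qed.

(** [ip_bismut] splits the trace into Levi-Civita terms, given by [koszul], minus the trace computed
    in [chern_trace]. *)
Lemma bismut_trace D C B z : levi_civita lb ip D -> chern_conn lb ip J C ->
  (forall x y, B x y = 2 *: nabla0 D J x y - C x y) ->
  ip (B z e`_0) e`_3 + ip (B z e`_1) e`_2 =
  (v1 + b1 / 2) * ip z e`_1 + (v2 + b2 / 2) * ip z e`_2 + al * ip z e`_3.
Proof.
move=> lcD chC BE; have ch := chern_trace z chC.
rewrite !(ip_bismut BE) J0 J1 J_frame2 J_frame3 !ipNr.
have k1 := koszul z e`_0 e`_3 lcD; have k2 := koszul z e`_1 e`_2 lcD.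
have k3 := koszul z e`_3 e`_0 lcD; have k4 := koszul z e`_2 e`_1 lcD.
move: ch k1 k2 k3 k4; rewrite sum_ord4 !inordK // !(frame_expand_ip z (lb _ _)).
rewrite !coord_lb !coord_J !ip_frame //= a0; lra.
Qed.

Lemma bismut_einstein_frame : bismut_einstein lb ip J e ->
  [/\ v1 * (v1 + b1 / 2) + v2 * (v2 + b2 / 2) = 0, al * (v1 + b1 / 2) = 0
    & al * (v2 + b2 / 2) = 0].
Proof.
move=> [B [lam [[D [C [lcD chC BE]]] eqs]]].
have ric x y := etrans (bismut_ric lcD chC BE x y) (bismut_trace (lb x y) lcD chC BE).
(* The first two pairs give the equations in [al], as F vanishes on them; the third gives [lam = 0];
   with this the last gives the quadratic equation. *)
move: (eqs e`_0 e`_2) (eqs e`_0 e`_1) (eqs e`_1 e`_2) (eqs e`_0 e`_3).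
rewrite /J_inv_part !ric !fund_formE !coord_lb J0 J1 J_frame2 J_frame3.
rewrite !ipNl !ip_frame //=.
move=> h1 h2 h3 h4; split; lra.
Qed.

End Bracket.
End Complex.
End Frame.

(** * Isomorphisms with the models *)

Lemma bijective_row4 (R : realType) (g : vectType R) (f : 'Hom(g, 'rV[R]_4)) :
  \dim {:g} = 4%N -> (forall x, f x = 0 -> x = 0) -> bijective f.
Proof.
move=> dim4 finj.
have ker0 : lker f == 0%VS.
  apply/eqP/vspaceP => x; rewrite memv_ker memv0.
  by apply/eqP/eqP => [/finj|->]; rewrite ?linear0.
have full : limg f = fullv.
  apply/eqP; rewrite eqEdim subvf /= (eqP (_ : \dim (limg f) == 4%N)).
    by rewrite dimvf /dim /=.
  by have := limg_ker_dim f fullv; rewrite (eqP ker0) capv0 dimv0 add0n dim4 => ->.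
exists f^-1%VF => x; first exact: lker0_lfunK.
by rewrite limg_lfunVK // full memvf.
Qed.

(** An isomorphism is specified by its four coordinate forms; by dimension, a trivial common kernel
    makes it bijective. *)
Lemma row4_isomorphic (R : realType) (g : vectType R) (lb : g -> g -> g)
    (lbh : 'rV[R]_4 -> 'rV[R]_4 -> 'rV[R]_4) (l0 l1 l2 l3 : g -> R) :
  let f x := row4 (l0 x) (l1 x) (l2 x) (l3 x) in
  \dim {:g} = 4%N ->
  linear (l0 : g -> R^o) -> linear (l1 : g -> R^o) -> linear (l2 : g -> R^o) ->
  linear (l3 : g -> R^o) ->
  (forall x, l0 x = 0 -> l1 x = 0 -> l2 x = 0 -> l3 x = 0 -> x = 0) ->
  (forall x y, f (lb x y) = lbh (f x) (f y)) -> lie_isomorphic lb lbh.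
Proof.
move=> f dim4 lin0 lin1 lin2 lin3 inj hom.
have linf : linear f.
  move=> c x y; apply: row4P; rewrite [in RHS]mxE [X in _ = X + _]mxE !row4E;
    [exact: lin0|exact: lin1|exact: lin2|exact: lin3].
pose fM := GRing.isLinear.Build _ _ _ _ _ linf.
pose fL : {linear g -> 'rV[R]_4} := HB.pack f fM.
have fE x : linfun fL x = f x by rewrite lfunE.
exists (linfun fL); split; last by move=> x y; rewrite !fE.
apply: bijective_row4 => // x; rewrite fE => fx.
by apply: inj;
  [have := congr1 (fun u : 'rV_4 => u 0 (inord 0)) fx
  |have := congr1 (fun u : 'rV_4 => u 0 (inord 1)) fx
  |have := congr1 (fun u : 'rV_4 => u 0 (inord 2)) fx
  |have := congr1 (fun u : 'rV_4 => u 0 (inord 3)) fx];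
  rewrite row4E mxE.
Qed.

Section Classification.
Context {R : realType} {g : vectType R}.
Context (lb : {bilinear g -> g -> g}) (ip : {dot g for idfun}) (e : 4.-tuple g).
Context (b1 b2 v1 v2 al : R).
Hypotheses (dim4 : \dim {:g} = 4%N) (frame : orthonormal_frame ip e).
Let m x y (i : nat) := ip x e`_3 * ip y e`_i - ip x e`_i * ip y e`_3.
Hypothesis lbE0 : forall x y, ip (lb x y) e`_0 = b1 * m x y 1 + b2 * m x y 2.
Hypothesis lbE1 : forall x y, ip (lb x y) e`_1 = v1 * m x y 0 - al * m x y 2.
Hypothesis lbE2 : forall x y, ip (lb x y) e`_2 = v2 * m x y 0 + al * m x y 1.
Hypothesis lbE3 : forall x y, ip (lb x y) e`_3 = 0.

Lemma frame_eq0 x : ip x e`_0 = 0 -> ip x e`_1 = 0 -> ip x e`_2 = 0 ->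
  ip x e`_3 = 0 -> x = 0.
Proof.
by move=> x0 x1 x2 x3; rewrite (frame_decomp frame x) x0 x1 x2 x3 !scale0r !addr0.
Qed.

(** The only bracket component is x_4 g(b, y) - y_4 g(b, x) along e_1. The fourth form is the
    coordinate on n_1 orthogonal to [b], and vanishes on the derived algebra. *)
Lemma heisenberg_isomorphic : al = 0 -> v1 = 0 -> v2 = 0 ->
  b1 ^+ 2 + b2 ^+ 2 != 0 -> lie_isomorphic lb (@A31_A1 R).
Proof.
move=> al0 v10 v20 b_neq0.
apply: (@row4_isomorphic _ _ lb _ (fun x => ip x e`_3)
  (fun x => b1 * ip x e`_1 + b2 * ip x e`_2) (fun x => ip x e`_0)
  (fun x => b1 * ip x e`_2 - b2 * ip x e`_1)) => //;
  try by move=> c x y; rewrite !(ipDl, ipZl) /GRing.scale /=; ring.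
- move=> x x3 bx x0 x12; apply: frame_eq0 => //; apply: (mulfI b_neq0).
    have -> : (b1 ^+ 2 + b2 ^+ 2) * ip x e`_1 = b1 * (b1 * ip x e`_1 + b2 * ip x e`_2)
      - b2 * (b1 * ip x e`_2 - b2 * ip x e`_1) by ring.
    by rewrite bx x12; ring.
  have -> : (b1 ^+ 2 + b2 ^+ 2) * ip x e`_2 = b2 * (b1 * ip x e`_1 + b2 * ip x e`_2)
    + b1 * (b1 * ip x e`_2 - b2 * ip x e`_1) by ring.
  by rewrite bx x12; ring.
- move=> x y; rewrite A31_A1E !row4E lbE0 lbE1 lbE2 lbE3 /m al0 v10 v20.
  by apply: row4P; rewrite !row4E; ring.
Qed.

(** Since b = -2v, the characteristic polynomial of M is t^3 + s t, whence [w]. The first form is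
    the e_2-coordinate of M x, which vanishes on the kernel of M; the second is the first composed
    with M, divided by [- w]. *)
Lemma euclid_isomorphic_al : al != 0 -> v1 + b1 / 2 = 0 -> v2 + b2 / 2 = 0 ->
  lie_isomorphic lb (@A36_A1 R).
Proof.
move=> al0 vb1 vb2.
have {vb1} b1E : b1 = - 2 * v1 by lra.
have {vb2} b2E : b2 = - 2 * v2 by lra.
pose s := al ^+ 2 + 2 * (v1 ^+ 2 + v2 ^+ 2); pose w := Num.sqrt s.
have al2 : 0 < al ^+ 2 by rewrite exprn_even_gt0.
have := sqr_ge0 v1; have := sqr_ge0 v2 => v22 v12.
have s0 : 0 < s by rewrite /s; lra.
have w0 : w != 0 by rewrite gt_eqF ?sqrtr_gt0.
have wE : w ^+ 2 = s by rewrite sqr_sqrtr // ltW.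
(* The first two forms span the dual of the rotation plane of [ad e_4]; the last
   one vanishes on the derived algebra. *)
apply: (@row4_isomorphic _ _ lb _ (fun x => v1 * ip x e`_0 - al * ip x e`_2)
  (fun x => (al * v2 * ip x e`_0 + (al ^+ 2 - v1 * b1) * ip x e`_1
     - v1 * b2 * ip x e`_2) / w)
  (fun x => w * ip x e`_3)
  (fun x => al * ip x e`_0 + b2 * ip x e`_1 - b1 * ip x e`_2)) => //;
  try by move=> c x y; rewrite !(ipDl, ipZl) /GRing.scale /=; ring.
- move=> x q0 q1 q2 q3.
  have x3 : ip x e`_3 = 0 by apply: (mulfI w0); rewrite mulr0.
  have {}q1 : al * v2 * ip x e`_0 + (al ^+ 2 - v1 * b1) * ip x e`_1
     - v1 * b2 * ip x e`_2 = 0.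
    by move/eqP: q1; rewrite mulf_eq0 invr_eq0 (negPf w0) orbF => /eqP.
  (* The determinant of the system formed by [q0] and [q3], solved for the coordinates along e_1 and
     e_3 in terms of that along e_2. Substitution into [q1] then leaves [p * s] times the latter. *)
  pose p := al ^+ 2 + 2 * v1 ^+ 2.
  have p0 : p != 0.
    by rewrite gt_eqF // /p; lra.
  have p0E : p * ip x e`_0 = 2 * al * v2 * ip x e`_1.
    have -> : p * ip x e`_0 = 2 * al * v2 * ip x e`_1
        + 2 * v1 * (v1 * ip x e`_0 - al * ip x e`_2)
        + al * (al * ip x e`_0 + b2 * ip x e`_1 - b1 * ip x e`_2).
      by rewrite /p b1E b2E; ring.
    by rewrite q0 q3 !mulr0 !addr0.
  have p2E : p * ip x e`_2 = 2 * v1 * v2 * ip x e`_1.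
    have -> : p * ip x e`_2 = 2 * v1 * v2 * ip x e`_1
        + v1 * (al * ip x e`_0 + b2 * ip x e`_1 - b1 * ip x e`_2)
        - al * (v1 * ip x e`_0 - al * ip x e`_2).
      by rewrite /p b1E b2E; ring.
    by rewrite q0 q3 !mulr0 subr0 addr0.
  have x1 : ip x e`_1 = 0.
    apply: (mulfI (mulf_neq0 p0 (lt0r_neq0 s0))); rewrite mulr0.
    have <- : p * (al * v2 * ip x e`_0 + (al ^+ 2 - v1 * b1) * ip x e`_1
        - v1 * b2 * ip x e`_2) = 0 by rewrite q1 mulr0.
    have -> : p * (al * v2 * ip x e`_0 + (al ^+ 2 - v1 * b1) * ip x e`_1
        - v1 * b2 * ip x e`_2) = al * v2 * (p * ip x e`_0)
        + p * (al ^+ 2 - v1 * b1) * ip x e`_1 - v1 * b2 * (p * ip x e`_2) by ring.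
    by rewrite p0E p2E b1E b2E /p /s; ring.
  by apply: frame_eq0 => //; apply: (mulfI p0);
    rewrite ?p0E ?p2E x1 !mulr0.
- move=> x y; rewrite A36_A1E !row4E lbE0 lbE1 lbE2 lbE3 /m.
  apply: row4P; rewrite !row4E.
  + by field.
  + apply: (mulIf w0); rewrite divfK //.
    set l0y := v1 * ip y e`_0 - _; set l0x := v1 * ip x e`_0 - _.
    have -> : (w * ip x e`_3 * l0y - l0x * (w * ip y e`_3)) * w =
      w ^+ 2 * (ip x e`_3 * l0y - l0x * ip y e`_3) by ring.
    by rewrite wE /s /l0x /l0y b1E b2E; ring.
  + by ring.
  + by rewrite b1E b2E; ring.
Qed.

(** M sends e_1 to v and v to g(b, v) e_1, so it rotates their span with [w ^+ 2] equal to -g(b, v).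
    The last form vanishes on that span, which is the derived algebra. *)
Lemma euclid_isomorphic_v : al = 0 -> b1 * v1 + b2 * v2 < 0 ->
  lie_isomorphic lb (@A36_A1 R).
Proof.
move=> al0 bv.
pose s := - (b1 * v1 + b2 * v2); pose w := Num.sqrt s.
have s0 : 0 < s by rewrite oppr_gt0.
have w0 : w != 0 by rewrite gt_eqF ?sqrtr_gt0.
have wE : w ^+ 2 = s by rewrite sqr_sqrtr // ltW.
apply: (@row4_isomorphic _ _ lb _ (fun x => ip x e`_0)
  (fun x => - (b1 * ip x e`_1 + b2 * ip x e`_2) / w) (fun x => w * ip x e`_3)
  (fun x => v1 * ip x e`_2 - v2 * ip x e`_1)) => //;
  try by move=> c x y; rewrite !(ipDl, ipZl) /GRing.scale /=; ring.
- move=> x x0 bx x3 vx.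
  have {}x3 : ip x e`_3 = 0 by apply: (mulfI w0); rewrite mulr0.
  have {}bx : b1 * ip x e`_1 + b2 * ip x e`_2 = 0.
    by move/eqP: bx; rewrite mulf_eq0 invr_eq0 (negPf w0) orbF oppr_eq0 => /eqP.
  apply: frame_eq0 => //; apply: (mulfI (lt0r_neq0 s0)); rewrite mulr0 /s.
    have -> : - (b1 * v1 + b2 * v2) * ip x e`_1 =
      - v1 * (b1 * ip x e`_1 + b2 * ip x e`_2)
      + b2 * (v1 * ip x e`_2 - v2 * ip x e`_1) by ring.
    by rewrite bx vx; ring.
  have -> : - (b1 * v1 + b2 * v2) * ip x e`_2 =
    - v2 * (b1 * ip x e`_1 + b2 * ip x e`_2)
    - b1 * (v1 * ip x e`_2 - v2 * ip x e`_1) by ring.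
  by rewrite bx vx; ring.
- move=> x y; rewrite A36_A1E !row4E lbE0 lbE1 lbE2 lbE3 /m al0.
  apply: row4P; rewrite !row4E.
  + by field.
  + apply: (mulIf w0); rewrite divfK //.
    have -> : (w * ip x e`_3 * ip y e`_0 - ip x e`_0 * (w * ip y e`_3)) * w =
      w ^+ 2 * (ip x e`_3 * ip y e`_0 - ip x e`_0 * ip y e`_3) by ring.
    by rewrite wE /s; ring.
  + by ring.
  + by ring.
Qed.
End Classification.

(** * Reading the algebraic data in the adapted frame, and the case distinction *)

Theorem theorem31 (R : realType) :
  (forall (g : vectType R) (lb : {bilinear g -> g -> g}) (n : {vspace g})
      (ip : {dot g for idfun}) (J : 'End(g)) (e : 4.-tuple g)
      (a : R) (b v : subvs_of (n_one J n)) (A : 'End(subvs_of (n_one J n))),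
    \dim {:g} = 4%N ->
    lie_axioms lb ->
    unimodular lb ->
    codim1_abelian_ideal lb n ->
    almost_hermitian ip J ->
    adapted_basis ip J n e ->
    algebraic_data lb ip e a b v A ->
    skew_endo ip A ->
    commutes_with_J J A ->
    (forall x y z t, ext_d3 lb (JdF lb ip J) x y z t = 0) /\
    (~ abelian_lie lb ->
     bismut_einstein lb ip J e ->
     (lie_isomorphic lb (@A36_A1 R) /\
        (~ kahler lb ip J -> ~ almost_kahler lb ip J)) \/
     (lie_isomorphic lb (@A31_A1 R) /\ almost_kahler lb ip J))) /\
  admits_compact_quotients (@A36_A1 R) /\
  admits_compact_quotients (@A31_A1 R).
Proof.
split; last first.
  by split; [exact: A36_A1_compact_quotients | exact: A31_A1_compact_quotients].
move=> g lb n ip J e a b v A dim4 [lb_alt _] unim [_ _ abel] herm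
  [frame nE J0 J1] [lb30 lbx] skewA _.
have in_n k : (k < 3)%N -> e`_k \in n.
  move=> k3; rewrite nE memv_span // !inE.
  by case: k k3 => [|[|[|]]] //; rewrite eqxx ?orbT.
have n_orth x : x \in n -> ip x e`_3 = 0.
  rewrite nE !span_cons span_nil addv0.
  move=> /memv_addP[_ /vlineP[k0 ->]].
  move=> [_ /memv_addP[_ /vlineP[k1 ->]] [_ /vlineP[k2 ->] ->] ->].
  by rewrite !(ipDl, ipZl) !(ip_frame frame) //=; ring.
have e1U : e`_1 \in n_one J n.
  rewrite memv_cap in_n //=; apply/memv_imgP; exists (- e`_2).
    by rewrite memvN in_n.
  by rewrite linearN /= (J_frame2 herm J1) opprK.
have e2U : e`_2 \in n_one J n.
  rewrite memv_cap in_n //=; apply/memv_imgP; exists e`_1; first exact: in_n.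
  by rewrite J1.
(* Lying in [n] kills the coordinate along e_4, and lying in its image under [J] the one along
   e_1. *)
have UE (u : subvs_of (n_one J n)) :
    vsval u = ip (vsval u) e`_1 *: e`_1 + ip (vsval u) e`_2 *: e`_2.
  have /memv_capP[un /memv_imgP[w wn uE]] := subvsP u.
  rewrite [LHS](frame_decomp frame) (n_orth _ un) {1}uE.
  by rewrite (coord_J herm J0 J1) (n_orth _ wn) oppr0 !scale0r add0r addr0.
pose x1 := vsproj (n_one J n) e`_1; pose x2 := vsproj (n_one J n) e`_2.
have x1E : vsval x1 = e`_1 by rewrite vsprojK.
have x2E : vsval x2 = e`_2 by rewrite vsprojK.
pose al := ip (vsval (A x1)) e`_2.
pose b1 := ip (vsval b) e`_1; pose b2 := ip (vsval b) e`_2.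
pose v1 := ip (vsval v) e`_1; pose v2 := ip (vsval v) e`_2.
(* A skew endomorphism of the plane n_1 is determined by the single number [al]. *)
have A11 : ip (vsval (A x1)) e`_1 = 0.
  by have := skewA x1 x1; rewrite x1E (ipC _ e`_1); lra.
have A22 : ip (vsval (A x2)) e`_2 = 0.
  by have := skewA x2 x2; rewrite x2E (ipC _ e`_2); lra.
have A21 : ip (vsval (A x2)) e`_1 = - al.
  by have := skewA x1 x2; rewrite x1E x2E (ipC _ e`_1) /al; lra.
have lb31 : lb e`_3 e`_1 = b1 *: e`_0 + al *: e`_2.
  by have := lbx x1; rewrite x1E [vsval (A x1)]UE A11 scale0r add0r.
have lb32 : lb e`_3 e`_2 = b2 *: e`_0 - al *: e`_1.
  by have := lbx x2; rewrite x2E [vsval (A x2)]UE A22 A21 scale0r addr0 scaleNr.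
rewrite [vsval v]UE -/v1 -/v2 in lb30.
have lb01 : lb e`_0 e`_1 = 0 by apply: abel; exact: in_n.
have lb02 : lb e`_0 e`_2 = 0 by apply: abel; exact: in_n.
have lb12 : lb e`_1 e`_2 = 0 by apply: abel; exact: in_n.
have a0 := unimodular_frame frame lb_alt lb30 lb31 lb32 unim.
have cE := coord_lb frame lb_alt lb01 lb02 lb12 lb30 lb31 lb32.
split.
  exact: (dJdF_frame frame herm J0 J1 lb_alt lb01 lb02 lb12 lb30 lb31 lb32 a0).
move=> nonab /(bismut_einstein_frame frame herm J0 J1 lb_alt lb01 lb02 lb12 lb30
  lb31 lb32 a0)[h1 h2 h3].
have akE := almost_kahler_frame frame herm J0 J1 lb_alt lb01 lb02 lb12 lb30 lb31
  lb32 a0.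
have [al0|al_neq0] := eqVneq al 0; last first.
  have vb1 : v1 + b1 / 2 = 0 by apply: (mulfI al_neq0); rewrite mulr0.
  have vb2 : v2 + b2 / 2 = 0 by apply: (mulfI al_neq0); rewrite mulr0.
  left; split.
    apply: (@euclid_isomorphic_al _ _ lb ip e b1 b2 v1 v2 al) => // x y;
      by rewrite cE ?a0 ?mul0r ?add0r.
  (* An almost-Kähler solution has v = 0, hence b = 0 by [vb1] and [vb2]; then [J] is integrable and
     the structure is Kähler. *)
  move=> nK ak; apply: nK; split=> //; move/akE: (ak) => [v10 v20].
  have b10 : b1 = 0 by lra.
  have b20 : b2 = 0 by lra.
  exact: (integrable_frame frame herm J0 J1 lb_alt lb01 lb02 lb12 lb30 lb31 lb32 a0).
have v_ge0 : 0 <= v1 ^+ 2 + v2 ^+ 2 by rewrite addr_ge0 ?sqr_ge0.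
have [v0|v_neq0] := eqVneq (v1 ^+ 2 + v2 ^+ 2) 0.
  have /andP[/eqP v10 /eqP v20] : (v1 == 0) && (v2 == 0).
    by move/eqP: v0; rewrite paddr_eq0 ?sqr_ge0 // !sqrf_eq0.
  right; split; last by apply/akE.
  apply: (@heisenberg_isomorphic _ _ lb ip e b1 b2 v1 v2 al) => //;
    try by move=> x y; rewrite cE ?a0 ?mul0r ?add0r.
  (* If [b] vanished too, all brackets would be zero, against [nonab]. *)
  apply/negP => /eqP/eqP; rewrite paddr_eq0 ?sqr_ge0 // !sqrf_eq0.
  move=> /andP[/eqP b10 /eqP b20]; apply: nonab => x y.
  apply: (frame_eq0 frame); rewrite cE ?a0 ?b10 ?b20 ?v10 ?v20 ?al0; ring.
have v_gt0 : 0 < v1 ^+ 2 + v2 ^+ 2 by rewrite lt_def v_neq0.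
left; split; last first.
  by move=> _ /akE[v10 v20]; move: v_neq0; rewrite v10 v20 expr0n addr0 eqxx.
apply: (@euclid_isomorphic_v _ _ lb ip e b1 b2 v1 v2 al) => //;
  try by move=> x y; rewrite cE ?a0 ?mul0r ?add0r.
(* [h1] reads g(b, v) = -2 g(v, v), which is negative. *)
move: h1 v_gt0; rewrite !expr2 => h1 v_gt0; lra.
Qed.
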